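(* Let $S^{si}\subseteq S$ and $S^{nsi}=S\setminus S^{si}$. Suppose $\mathcal{T}_1$ is stably infinite w.r.t. $S^{si}$ and one of the following holds: (1) $\mathcal{T}_2$ is strongly stably infinite w.r.t. $(S^{si}, S^{nsi})$ and strongly polite w.r.t. $S^{nsi}$ with a witness $\mathit{wit}$; (2) $\mathcal{T}_2$ is stably infinite w.r.t. $(S^{si}, S^{nsi})$, smooth w.r.t. $(S^{nsi},S^{si})$, and strongly finitely witnessable w.r.t. $S^{nsi}$ with a witness $\mathit{wit}$; (3) $\mathcal{T}_2$ is stably infinite w.r.t. $S^{si}$ and both smooth and strongly finitely witnessable w.r.t. $(S^{nsi}, S^{si})$ with a witness $\mathit{wit}$. Then the following are equivalent: (a) $\Gamma_1\cup \Gamma_2$ is $(\mathcal{T}_1\oplus \mathcal{T}_2)$-satisfiable; (b) there exists an arrangement $\delta_V$ over $V$ such that $\Gamma_1\cup \delta_V$ is $\mathcal{T}_1$-satisfiable and $\mathit{wit}(\Gamma_2)\cup \delta_V$ is $\mathcal{T}_2$-satisfiable, where $V=\bigcup_{\sigma\in S}V_{\sigma}$, with $V_{\sigma}=\mathit{FV}_{\sigma}(\mathit{wit}(\Gamma_2))$ for every $\sigma\in S^{nsi}$ and $V_{\sigma}=\mathit{FV}_{\sigma}(\Gamma_1)\cap\mathit{FV}_{\sigma}(\mathit{wit}(\Gamma_2))$ for every $\sigma\in S^{si}$.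
   Context: Many-sorted first-order logic with equality. $\Sigma_1$ and $\Sigma_2$ are disjoint signatures (sharing only the equality symbols), $S$ is the set of sorts common to $\Sigma_1$ and $\Sigma_2$, $\mathcal{T}_1$ is a $\Sigma_1$-theory, $\mathcal{T}_2$ is a $\Sigma_2$-theory, $\Gamma_1$ is a set of $\Sigma_1$-literals and $\Gamma_2$ is a set of $\Sigma_2$-literals. $\mathcal{T}_1\oplus\mathcal{T}_2$ is the class of $\Sigma_1\cup\Sigma_2$-structures whose reducts to $\Sigma_i$ lie in $\mathcal{T}_i$. $\mathit{FV}_\sigma(\varphi)$ denotes the set of free variables of sort $\sigma$ in $\varphi$. An arrangement of a finite set of variables $V$ is a conjunction of equalities $x=y$ for $(x,y)$ in some equivalence relation $E_\sigma$ on the variables of each sort $\sigma$, and disequalities $x\neq y$ for same-sort pairs not in $E_\sigma$. Definitions (for a $\Sigma$-theory $\mathcal{T}$ and disjoint sort sets $S_1,S_2$): $\mathcal{T}$ is stably infinite w.r.t. $S_1$ if every $\mathcal{T}$-satisfiable quantifier-free formula is satisfied by a $\mathcal{T}$-interpretation in which every sort of $S_1$ is infinite. $\mathcal{T}$ is (strongly) stably infinite w.r.t. $(S_1,S_2)$ if for every quantifier-free $\phi$ and $\mathcal{T}$-interpretation $\mathcal{A}\models\phi$ there is a $\mathcal{T}$-interpretation $\mathcal{B}\models\phi$ with $\sigma^{\mathcal{B}}$ infinite for $\sigma\in S_1$ and $|\sigma^{\mathcal{B}}|\le|\sigma^{\mathcal{A}}|$ (resp. $=$) for $\sigma\in S_2$.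 $\mathcal{T}$ is smooth w.r.t. $S_1$ if for every quantifier-free $\phi$, $\mathcal{T}$-interpretation $\mathcal{A}\models\phi$ and cardinal assignment $\kappa$ on $S_1$ with $\kappa(\sigma)\ge|\sigma^{\mathcal{A}}|$, some $\mathcal{T}$-interpretation satisfying $\phi$ has $|\sigma|=\kappa(\sigma)$ for all $\sigma\in S_1$; smooth w.r.t. $(S_1,S_2)$ additionally requires $|\sigma^{\mathcal{B}}|$ infinite whenever $|\sigma^{\mathcal{A}}|$ is infinite, for $\sigma\in S_2$. An interpretation $\mathcal{A}$ finitely witnesses $\phi$ w.r.t. $S_1$ if $\mathcal{A}\models\phi$ and $\sigma^{\mathcal{A}}=\mathit{FV}_\sigma(\phi)^{\mathcal{A}}$ for all $\sigma\in S_1$. A computable function $\mathit{wit}$ on quantifier-free formulas is a strong witness w.r.t. $S_1$ if $\phi$ and $\exists\vec w.\,\mathit{wit}(\phi)$ are $\mathcal{T}$-equivalent ($\vec w$ the new variables) and for every arrangement $\delta$ of variables of sorts in $S_1$, $\mathit{wit}(\phi)\wedge\delta$ is either $\mathcal{T}$-unsatisfiable or finitely witnessed by a $\mathcal{T}$-interpretation; strongly finitely witnessable w.r.t. $(S_1,S_2)$ additionally requires that whenever a $\mathcal{T}$-interpretation $\mathcal{A}$ satisfies $\mathit{wit}(\phi)\wedge\delta$, the finite witness $\mathcal{B}$ can be chosen with $\sigma^{\mathcal{B}}$ infinite whenever $\sigma^{\mathcal{A}}$ is infinite for $\sigma\in S_2$. Strongly polite = smooth and strongly finitely witnessable.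
   Formalization: The strong-witness condition is required for arrangements of variables of all shared sorts S, not only S^nsi (the claim fails otherwise); the new variables of wit(Γ2) are assumed not to occur in Γ1; signatures are countable and Γ2 is finite. *)

(* Defs.v *)
From mathcomp Require Import all_boot.
From mathcomp Require Import boolp classical_sets functions cardinality.

Set Implicit Arguments.
Unset Strict Implicit.
Unset Printing Implicit Defensive.

Local Open Scope classical_set_scope.
Local Open Scope card_scope.

(** * Syntax *)

(* A signature whose set of sorts is [K].  The equality symbols are logical and
   therefore not listed.  Sorts and symbols are countable, their [pickle] being
   the numbering with respect to which functions on formulas are computable. *)
Record signature (K : countType) := Signature {
  fn : countType;
  fn_dom : fn -> seq K;
  fn_cod : fn -> K;
  pr : countType;
  pr_dom : pr -> seq K
}.

Section Syntax.
Variables (K : countType) (Sg : signature K).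

Inductive term : K -> Type :=
| Var (k : K) (n : nat) : term k
| App (f : fn Sg) (ts : terms (fn_dom f)) : term (fn_cod f)
with terms : seq K -> Type :=
| TNil : terms [::]
| TCons (k : K) (l : seq K) (t : term k) (ts : terms l) : terms (k :: l).

(* [All k n] and [Ex k n] bind the [n]-th variable of sort [k]. *)
Inductive formula : Type :=
| Eq (k : K) (t u : term k)
| Rel (p : pr Sg) (ts : terms (pr_dom p))
| Bot
| Not (phi : formula)
| And (phi psi : formula)
| Or (phi psi : formula)
| Imp (phi psi : formula)
| All (k : K) (n : nat) (phi : formula)
| Ex (k : K) (n : nat) (phi : formula).

Fixpoint term_vars (k : K) (t : term k) : seq (K * nat) :=
  match t with
  | Var k n => [:: (k, n)]
  | App f ts => terms_vars ts
  end
with terms_vars (l : seq K) (ts : terms l) : seq (K * nat) :=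
  match ts with
  | TNil => [::]
  | TCons _ _ t ts => term_vars t ++ terms_vars ts
  end.

Fixpoint FV (phi : formula) : seq (K * nat) :=
  match phi with
  | Eq _ t u => term_vars t ++ term_vars u
  | Rel _ ts => terms_vars ts
  | Bot => [::]
  | Not f => FV f
  | And f g | Or f g | Imp f g => FV f ++ FV g
  | All k n f | Ex k n f => [seq v <- FV f | v != (k, n)]
  end.

Definition FVs (G : set formula) : set (K * nat) :=
  [set v | exists2 phi, G phi & v \in FV phi].

Fixpoint qf (phi : formula) : bool :=
  match phi with
  | Eq _ _ _ | Rel _ _ | Bot => true
  | Not f => qf f
  | And f g | Or f g | Imp f g => qf f && qf g
  | All _ _ _ | Ex _ _ _ => false
  end.

Definition atom (phi : formula) : bool :=
  match phi with Eq _ _ _ | Rel _ _ => true | _ => false end.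

Definition literal (phi : formula) : bool :=
  match phi with Not f => atom f | _ => atom phi end.

Definition sentence (phi : formula) : Prop := FV phi = [::].

Definition conj (l : seq formula) : formula := foldr And (Not Bot) l.

Definition exists_vars (ws : seq (K * nat)) (phi : formula) : formula :=
  foldr (fun w => Ex w.1 w.2) phi ws.

End Syntax.

Arguments Var {K Sg} k n.
Arguments App {K Sg} f ts.
Arguments TNil {K Sg}.
Arguments TCons {K Sg k l} t ts.
Arguments Eq {K Sg} k t u.
Arguments Rel {K Sg} p ts.
Arguments Bot {K Sg}.

(** * Semantics *)

(* Carriers of structures and cardinal assignments share this type, so that both
   range over the same universe. *)
Definition family (K : Type) := K -> Type.

Fixpoint args (K : Type) (D : family K) (l : seq K) : Type :=
  if l is k :: l' then (D k * args D l')%type else unit.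

Section Semantics.
Variables (K : countType) (Sg : signature K).

Record structure := Structure {
  dom : family K;
  dom_inhabited : forall k, inhabited (dom k);
  fn_int : forall f : fn Sg, args dom (fn_dom f) -> dom (fn_cod f);
  pr_int : forall p : pr Sg, args dom (pr_dom p) -> Prop
}.

Definition assignment (D : family K) := forall k, nat -> D k.

Record interpretation := Interpretation {
  str :> structure;
  asg : assignment (dom str)
}.

Definition update (D : family K) (rho : assignment D) k n (d : D k)
    : assignment D :=
  fun k' n' =>
    match @eqP K k k' with
    | ReflectT e => if n == n' then eq_rect k D d k' e else rho k' n'
    | ReflectF _ => rho k' n'
    end.

Section Eval.
Variables (A : structure) (rho : assignment (dom A)).

Fixpoint eval (k : K) (t : term Sg k) : dom A k :=
  match t in term _ k return dom A k with
  | Var k n => rho k n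
  | App f ts => fn_int (evals ts)
  end
with evals (l : seq K) (ts : terms Sg l) : args (dom A) l :=
  match ts in terms _ l return args (dom A) l with
  | TNil => tt
  | TCons _ _ t ts => (eval t, evals ts)
  end.

End Eval.

Fixpoint sat (A : structure) (rho : assignment (dom A)) (phi : formula Sg)
    : Prop :=
  match phi with
  | Eq _ t u => eval rho t = eval rho u
  | Rel _ ts => pr_int (evals rho ts)
  | Bot => False
  | Not f => ~ sat rho f
  | And f g => sat rho f /\ sat rho g
  | Or f g => sat rho f \/ sat rho g
  | Imp f g => sat rho f -> sat rho g
  | All k n f => forall d : dom A k, sat (update rho n d) f
  | Ex k n f => exists d : dom A k, sat (update rho n d) f
  end.

Definition models (I : interpretation) (phi : formula Sg) : Prop :=
  sat (asg I) phi.

(* A theory is a class of structures; [is_theory] says that it is the class of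
   all models of some set of sentences. *)
Definition is_theory (T : structure -> Prop) : Prop :=
  exists2 Ax : set (formula Sg), (forall phi, Ax phi -> sentence phi) &
    forall A, T A <->
      (forall phi, Ax phi -> forall rho : assignment (dom A), sat rho phi).

Variable T : structure -> Prop.

Definition satisfiable (G : set (formula Sg)) : Prop :=
  exists2 I : interpretation, T I & forall phi, G phi -> models I phi.

Definition equivalent (phi psi : formula Sg) : Prop :=
  forall I : interpretation, T I -> (models I phi <-> models I psi).

End Semantics.

(** * Arrangements *)

Section Arrangement.
Variables (K K' : countType) (Sg : signature K) (i : K' -> K).

(* The variables are taken with sorts in [K'] and read in [Sg] along [i], so
   that a single arrangement of variables of common sorts can be stated in two
   signatures. *)
Definition arrangement (V : seq (K' * nat)) (E : K' -> rel nat) : formula Sg :=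
  conj [seq (let e := Eq (i x.1) (Var (i x.1) x.2) (Var (i x.1) y.2) in
             if E x.1 x.2 y.2 then e else Not e)
       | x <- V, y <- [seq y <- V | y.1 == x.1]].

End Arrangement.

Definition equivalences (K : countType) (E : K -> rel nat) : Prop :=
  forall k, equivalence_rel (E k).

(** * Computable functions on formulas *)

Inductive recfun :=
| RZero
| RSucc
| RProj (i : nat)
| RComp (f : recfun) (gs : seq recfun)
| RRec (f g : recfun)
| RMin (f : recfun).

Inductive computes : recfun -> seq nat -> nat -> Prop :=
| C_zero xs : computes RZero xs 0
| C_succ x xs : computes RSucc (x :: xs) x.+1
| C_proj i xs : i < size xs -> computes (RProj i) xs (nth 0 xs i)
| C_comp f gs xs ys z : computes_all gs xs ys -> computes f ys z ->
    computes (RComp f gs) xs z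
| C_rec0 f g xs z : computes f xs z -> computes (RRec f g) (0 :: xs) z
| C_recS f g n xs y z : computes (RRec f g) (n :: xs) y ->
    computes g (n :: y :: xs) z -> computes (RRec f g) (n.+1 :: xs) z
| C_min f n xs : computes f (n :: xs) 0 ->
    (forall m, m < n -> exists k, computes f (m :: xs) k.+1) ->
    computes (RMin f) xs n
with computes_all : seq recfun -> seq nat -> seq nat -> Prop :=
| C_nil xs : computes_all [::] xs [::]
| C_cons g gs xs y ys : computes g xs y -> computes_all gs xs ys ->
    computes_all (g :: gs) xs (y :: ys).

Section Computable.
Variables (K : countType) (Sg : signature K).

Import GenTree.

Fixpoint term_tree (k : K) (t : term Sg k) : tree nat :=
  match t with
  | Var k n => Node 0 [:: Leaf (pickle k); Leaf n]
  | App f ts => Node 1 (Leaf (pickle f) :: terms_trees ts)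
  end
with terms_trees (l : seq K) (ts : terms Sg l) : seq (tree nat) :=
  match ts with
  | TNil => [::]
  | TCons _ _ t ts => term_tree t :: terms_trees ts
  end.

Fixpoint formula_tree (phi : formula Sg) : tree nat :=
  match phi with
  | Eq k t u => Node 2 [:: Leaf (pickle k); term_tree t; term_tree u]
  | Rel p ts => Node 3 (Leaf (pickle p) :: terms_trees ts)
  | Bot => Node 4 [::]
  | Not f => Node 5 [:: formula_tree f]
  | And f g => Node 6 [:: formula_tree f; formula_tree g]
  | Or f g => Node 7 [:: formula_tree f; formula_tree g]
  | Imp f g => Node 8 [:: formula_tree f; formula_tree g]
  | All k n f => Node 9 [:: Leaf (pickle k); Leaf n; formula_tree f]
  | Ex k n f => Node 10 [:: Leaf (pickle k); Leaf n; formula_tree f]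
  end.

Definition code (phi : formula Sg) : nat := pickle (formula_tree phi).

Definition computable_on_qf (w : formula Sg -> formula Sg) : Prop :=
  exists r : recfun, forall phi, qf phi -> computes r [:: code phi] (code (w phi)).

End Computable.

(** * Stable infiniteness, smoothness, witnesses *)

Definition infinite (X : Type) : Prop := infinite_set [set: X].

Section Properties.
Variables (K : countType) (Sg : signature K) (T : structure Sg -> Prop).
Implicit Types (A B : interpretation Sg) (phi : formula Sg).

Definition stably_infinite (S1 : set K) : Prop :=
  forall phi, qf phi -> satisfiable T [set phi] ->
    exists B, [/\ T B, models B phi & forall k, S1 k -> infinite (dom B k)].

Definition stably_infinite2 (S1 S2 : set K) : Prop :=
  forall phi A, qf phi -> T A -> models A phi ->
    exists B, [/\ T B, models B phi,
      forall k, S1 k -> infinite (dom B k) &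
      forall k, S2 k -> [set: dom B k] #<= [set: dom A k]].

Definition strongly_stably_infinite (S1 S2 : set K) : Prop :=
  forall phi A, qf phi -> T A -> models A phi ->
    exists B, [/\ T B, models B phi,
      forall k, S1 k -> infinite (dom B k) &
      forall k, S2 k -> [set: dom B k] #= [set: dom A k]].

(* A cardinal assignment is given by a family of types, of which only the
   cardinalities at the sorts of [S1] matter. *)
Definition smooth (S1 : set K) : Prop :=
  forall phi A (kappa : family K), qf phi -> T A -> models A phi ->
    (forall k, S1 k -> [set: dom A k] #<= [set: kappa k]) ->
    exists B, [/\ T B, models B phi &
      forall k, S1 k -> [set: dom B k] #= [set: kappa k]].

Definition smooth2 (S1 S2 : set K) : Prop :=
  forall phi A (kappa : family K), qf phi -> T A -> models A phi ->
    (forall k, S1 k -> [set: dom A k] #<= [set: kappa k]) ->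
    exists B, [/\ T B, models B phi,
      forall k, S1 k -> [set: dom B k] #= [set: kappa k] &
      forall k, S2 k -> infinite (dom A k) -> infinite (dom B k)].

Definition finitely_witnesses A (S1 : set K) phi : Prop :=
  models A phi /\
  forall k, S1 k -> forall d : dom A k, exists2 n, (k, n) \in FV phi & asg A k n = d.

Definition new_vars (wit : formula Sg -> formula Sg) phi : seq (K * nat) :=
  [seq v <- FV (wit phi) | v \notin FV phi].

Definition pre_witness (wit : formula Sg -> formula Sg) : Prop :=
  [/\ computable_on_qf wit,
      forall phi, qf phi -> qf (wit phi) &
      forall phi, qf phi ->
        equivalent T phi (exists_vars (new_vars wit phi) (wit phi))].

(* [R] is the set of sorts of the variables that are arranged.  The usual
   notion is the case [R = S1].  When a theory is combined along more sorts
   than those of [S1], arrangements of the variables of all the shared sorts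
   have to be preserved by the finite witness, which does not follow from
   [R = S1]; then [R] is the set of shared sorts. *)
Definition strong_witness (R S1 : set K) (wit : formula Sg -> formula Sg) : Prop :=
  pre_witness wit /\
  forall phi (V : seq (K * nat)) (E : K -> rel nat), qf phi ->
    (forall v, v \in V -> R v.1) -> equivalences E ->
    let psi := And (wit phi) (arrangement Sg id V E) in
    satisfiable T [set psi] -> exists2 B : interpretation Sg, T B & finitely_witnesses B S1 psi.

Definition strong_witness2 (R S1 S2 : set K) (wit : formula Sg -> formula Sg)
    : Prop :=
  pre_witness wit /\
  forall phi (V : seq (K * nat)) (E : K -> rel nat), qf phi ->
    (forall v, v \in V -> R v.1) -> equivalences E ->
    let psi := And (wit phi) (arrangement Sg id V E) in
    forall A, T A -> models A psi ->
      exists B, [/\ T B, finitely_witnesses B S1 psi &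
        forall k, S2 k -> infinite (dom A k) -> infinite (dom B k)].

Definition strongly_polite (R S1 : set K) (wit : formula Sg -> formula Sg) : Prop :=
  smooth S1 /\ strong_witness R S1 wit.

End Properties.

(** * Signature inclusions, disjoint unions and combinations *)

(* An inclusion of a signature [Sg] with sorts [K] into [Sg'] with sorts [K']
   is given by a map [h] on sorts together with the images of the symbols; these
   are presented at the arities [map h _] in order to avoid casts. *)

Section Translation.
Variables (K K' : countType) (h : K -> K').
Variables (Sg : signature K) (Sg' : signature K').
Variables
  (app : forall f : fn Sg, terms Sg' (map h (fn_dom f)) -> term Sg' (h (fn_cod f)))
  (rel : forall p : pr Sg, terms Sg' (map h (pr_dom p)) -> formula Sg').

Fixpoint tr_term (k : K) (t : term Sg k) : term Sg' (h k) :=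
  match t in term _ k return term Sg' (h k) with
  | Var k n => Var (h k) n
  | App f ts => app (tr_terms ts)
  end
with tr_terms (l : seq K) (ts : terms Sg l) : terms Sg' (map h l) :=
  match ts in terms _ l return terms Sg' (map h l) with
  | TNil => TNil
  | TCons _ _ t ts => TCons (tr_term t) (tr_terms ts)
  end.

Fixpoint tr_formula (phi : formula Sg) : formula Sg' :=
  match phi with
  | Eq k t u => Eq (h k) (tr_term t) (tr_term u)
  | Rel _ ts => rel (tr_terms ts)
  | Bot => Bot
  | Not f => Not (tr_formula f)
  | And f g => And (tr_formula f) (tr_formula g)
  | Or f g => Or (tr_formula f) (tr_formula g)
  | Imp f g => Imp (tr_formula f) (tr_formula g)
  | All k n f => All (h k) n (tr_formula f)
  | Ex k n f => Ex (h k) n (tr_formula f)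
  end.

End Translation.

Fixpoint args_map (K K' : Type) (h : K -> K') (D : family K') (l : seq K)
    : args (fun k => D (h k)) l -> args D (map h l) :=
  match l return args (fun k => D (h k)) l -> args D (map h l) with
  | [::] => id
  | k :: l => fun x => (x.1, args_map x.2)
  end.

(* Two disjoint signatures are presented with [C] as the set of common sorts and
   [E1], [E2] as the sets of the sorts proper to each of them; their union has
   the sorts [C + (E1 + E2)], and the disjoint sums of the sets of symbols. *)
Section Combination.
Variables (C E1 E2 : countType).
Variables (Sg1 : signature (C + E1)%type) (Sg2 : signature (C + E2)%type).

Definition sort1 (k : C + E1) : C + (E1 + E2) :=
  match k with inl c => inl c | inr e => inr (inl e) end.

Definition sort2 (k : C + E2) : C + (E1 + E2) :=
  match k with inl c => inl c | inr e => inr (inr e) end.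

Definition union_signature : signature (C + (E1 + E2))%type := {|
  fn := (fn Sg1 + fn Sg2)%type;
  fn_dom f := match f with
    inl f => map sort1 (fn_dom f) | inr f => map sort2 (fn_dom f) end;
  fn_cod f := match f with
    inl f => sort1 (fn_cod f) | inr f => sort2 (fn_cod f) end;
  pr := (pr Sg1 + pr Sg2)%type;
  pr_dom p := match p with
    inl p => map sort1 (pr_dom p) | inr p => map sort2 (pr_dom p) end
|}.

Definition emb1 : formula Sg1 -> formula union_signature :=
  tr_formula (fun f => @App _ union_signature (inl f))
             (fun p => @Rel _ union_signature (inl p)).

Definition emb2 : formula Sg2 -> formula union_signature :=
  tr_formula (fun f => @App _ union_signature (inr f))
             (fun p => @Rel _ union_signature (inr p)).

Definition reduct1 (A : structure union_signature) : structure Sg1 :=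
  @Structure _ Sg1 (fun k => dom A (sort1 k))
    (fun k => dom_inhabited A (sort1 k))
    (fun f x => @fn_int _ _ A (inl f) (args_map x))
    (fun p x => @pr_int _ _ A (inl p) (args_map x)).

Definition reduct2 (A : structure union_signature) : structure Sg2 :=
  @Structure _ Sg2 (fun k => dom A (sort2 k))
    (fun k => dom_inhabited A (sort2 k))
    (fun f x => @fn_int _ _ A (inr f) (args_map x))
    (fun p x => @pr_int _ _ A (inr p) (args_map x)).

Definition combination (T1 : structure Sg1 -> Prop) (T2 : structure Sg2 -> Prop)
    (A : structure union_signature) : Prop :=
  T1 (reduct1 A) /\ T2 (reduct2 A).

End Combination.

Arguments emb1 {C E1 E2 Sg1} Sg2 phi.
Arguments emb2 {C E1 E2} Sg1 {Sg2} phi.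

(* Main.v *)
(** If the combined theory has a model, the arrangement is read off from its
    values, once the variables introduced by [wit] have been given values.

    Conversely, compactness (by an ultraproduct over the finite subsets of
    [Gamma1]) and the downward Loewenheim-Skolem theorem give a countable model
    [A1] of [Gamma1] and the arrangement in which the sorts of [Ssi] are
    infinite.  A finite witness for [wit Gamma2] and the arrangement has, at each
    shared sort outside [Ssi], at most as many elements as [A1], because there
    every element is the value of an arranged variable.  Smoothness and stable
    infiniteness, in the order permitted by the case at hand, turn it into a
    model with infinite sorts in [Ssi] and the cardinalities of [A1] at the other
    shared sorts; Loewenheim-Skolem makes it countable.  The two models then have
    equinumerous shared sorts, and as they realise the same arrangement the
    bijections can be chosen to match the values of the variables in [V].  A
    variable of [Gamma1] and [Gamma2] may fail to occur in [wit Gamma2]; it takes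
    its value from [A1], which preserves [wit Gamma2] and hence [Gamma2]. *)

Require Import Defs.
From Stdlib Require List.
From mathcomp Require Import all_boot.
From mathcomp Require Import boolp classical_sets functions cardinality filter.

Set Implicit Arguments.
Unset Strict Implicit.
Unset Printing Implicit Defensive.

Local Open Scope classical_set_scope.
Local Open Scope card_scope.

(* [finfun] shadows [family]. *)
Local Notation family := Defs.family.

(** * Syntax and satisfaction *)

Scheme term_mut := Induction for term Sort Prop
with terms_mut := Induction for terms Sort Prop.
Combined Scheme term_terms_ind from term_mut, terms_mut.

Lemma existT_inj (I : eqType) (T_ : I -> Type) i :
  injective (existT T_ i).
Proof. by move=> t u; apply: eq_from_Tagged. Qed.

(** * Injectivity of the coding of formulas *)

Section Codes.
Variables (K : countType) (Sg : signature K).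

(** The sort of [App f ts] is computed from [f], so terms cannot be compared by cases at one fixed
    sort; the induction lets the sorts differ and compares dependent pairs. *)
Lemma term_tree_inj_dep :
  (forall k (t : term Sg k) k' (t' : term Sg k'), term_tree t = term_tree t' ->
     existT (term Sg) k t = existT (term Sg) k' t') /\
  (forall l (ts : terms Sg l) l' (ts' : terms Sg l'),
     terms_trees ts = terms_trees ts' ->
     existT (terms Sg) l ts = existT (terms Sg) l' ts').
Proof.
apply: term_terms_ind.
- move=> k n k' [{}k' n'|f ts] //= [/(pcan_inj pickleK) -> ->] //.
- move=> f ts IH k' [{}k' n'|f' ts'] //= [/(pcan_inj pickleK) ff'].
  by subst f' => eq_ts; rewrite (existT_inj (IH _ _ eq_ts)).
- by move=> l' [].
- move=> k l t IHt ts IHts l' [|k' {}l' t' ts'] //= [/IHt eq_t /IHts eq_ts].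
  have /= kk' := congr1 (@projT1 _ _) eq_t; have /= ll' := congr1 (@projT1 _ _) eq_ts.
  by subst k' l'; rewrite (existT_inj eq_t) (existT_inj eq_ts).
Qed.

Lemma term_tree_inj k : injective (@term_tree K Sg k).
Proof. by move=> t u /(proj1 term_tree_inj_dep) eq_tu; apply: existT_inj eq_tu. Qed.

Lemma terms_trees_inj l : injective (@terms_trees K Sg l).
Proof. by move=> t u /(proj2 term_tree_inj_dep) eq_tu; apply: existT_inj eq_tu. Qed.

Lemma code_inj : injective (@code K Sg).
Proof.
move=> phi psi /(pcan_inj pickleK).
elim: phi psi => [k t u|p ts||f IHf|f IHf g IHg|f IHf g IHg|f IHf g IHg
    |k n f IHf|k n f IHf] [k' t' u'|p' ts'||f'|f' g'|f' g'|f' g'|k' n' f'|k' n' f'] //=.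
- case=> /(pcan_inj pickleK) kk'; subst k'.
  by move=> /term_tree_inj -> /term_tree_inj ->.
- by case=> /(pcan_inj pickleK) pp'; subst p' => /terms_trees_inj ->.
- by case=> /IHf ->.
- by case=> /IHf -> /IHg ->.
- by case=> /IHf -> /IHg ->.
- by case=> /IHf -> /IHg ->.
- by case=> /(pcan_inj pickleK) -> -> /IHf ->.
- by case=> /(pcan_inj pickleK) -> -> /IHf ->.
Qed.

End Codes.

Section Coincidence.
Variables (K : countType) (Sg : signature K).

Lemma update_eq (D : family K) (rho : assignment D) k n (d : D k) :
  update rho n d k n = d.
Proof. by rewrite /update; case: eqP => // e; rewrite eqxx (eq_irrelevance e erefl). Qed.

Lemma update_neq (D : family K) (rho : assignment D) k n (d : D k) k' n' :
  (k', n') != (k, n) -> update rho n d k' n' = rho k' n'.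
Proof.
rewrite /update; case: eqP => // e; case: _ / e.
by rewrite xpair_eqE eqxx /= eq_sym => /negPf ->.
Qed.

Lemma update_map (D D' : family K) (e : forall k, D k -> D' k)
    (rho : assignment D) k n (d : D k) :
  (fun k' n' => e k' (update rho n d k' n')) =
  update (fun k' n' => e k' (rho k' n')) n (e k d).
Proof.
apply: functional_extensionality_dep => k'; apply: funext => n'.
case: (eqVneq (k', n') (k, n)) => [[-> ->]|neq]; first by rewrite !update_eq.
by rewrite !update_neq.
Qed.

Lemma eval_ext (A : structure Sg) (rho rho' : assignment (dom A)) :
  (forall k (t : term Sg k), {in term_vars t, forall v, rho v.1 v.2 = rho' v.1 v.2} ->
     eval rho t = eval rho' t) /\
  (forall l (ts : terms Sg l),
     {in terms_vars ts, forall v, rho v.1 v.2 = rho' v.1 v.2} ->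
     evals rho ts = evals rho' ts).
Proof.
apply: term_terms_ind => //=.
- by move=> k n /(_ (k, n)); apply; rewrite inE.
- by move=> f ts IH /IH ->.
- move=> k l t IHt ts IHts eq_rho; rewrite IHt ?IHts // => v v_in;
  by apply: eq_rho; rewrite mem_cat v_in ?orbT.
Qed.

Lemma sat_ext (A : structure Sg) phi (rho rho' : assignment (dom A)) :
  {in FV phi, forall v, rho v.1 v.2 = rho' v.1 v.2} ->
  sat rho phi <-> sat rho' phi.
Proof.
have cat_in (f g : formula Sg) (r r' : assignment (dom A)) :
    {in FV f ++ FV g, forall v, r v.1 v.2 = r' v.1 v.2} ->
    {in FV f, forall v, r v.1 v.2 = r' v.1 v.2} /\
    {in FV g, forall v, r v.1 v.2 = r' v.1 v.2}.
  by move=> r_eq; split=> v v_in; apply: r_eq; rewrite mem_cat v_in ?orbT.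
have upd_in k n (d : dom A k) (f : formula Sg) (r r' : assignment (dom A)) :
    {in [seq v <- FV f | v != (k, n)], forall v, r v.1 v.2 = r' v.1 v.2} ->
    {in FV f, forall v, update r n d v.1 v.2 = update r' n d v.1 v.2}.
  move=> r_eq [k' n'] v_in /=.
  case: (eqVneq (k', n') (k, n)) => [[-> ->]|neq]; first by rewrite !update_eq.
  by rewrite !update_neq //; apply: (r_eq (k', n')); rewrite mem_filter neq.
elim: phi rho rho' => [k t u|p ts||f IHf|f IHf g IHg|f IHf g IHg|f IHf g IHg
    |k n f IHf|k n f IHf] rho rho' //=.
- move=> r_eq; rewrite (proj1 (eval_ext rho rho') _ t) ?(proj1 (eval_ext rho rho') _ u) //
    => v v_in; by apply: r_eq; rewrite mem_cat v_in ?orbT.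
- by move=> /(proj2 (eval_ext rho rho')) ->.
- by move=> /IHf ->.
- by move=> /cat_in[/IHf -> /IHg ->].
- by move=> /cat_in[/IHf -> /IHg ->].
- by move=> /cat_in[/IHf -> /IHg ->].
- by move=> /upd_in r_eq; split=> sat_f d; apply/(IHf _ _ (r_eq d)).
- by move=> /upd_in r_eq; split=> -[d sat_f]; exists d; apply/(IHf _ _ (r_eq d)).
Qed.

End Coincidence.

Fixpoint args_hom (K : Type) (D D' : family K) (e : forall k, D k -> D' k)
    (l : seq K) : args D l -> args D' l :=
  match l return args D l -> args D' l with
  | [::] => id
  | k :: l => fun x => (e k x.1, args_hom e x.2)
  end.

(** * Elementary embeddings and isomorphisms *)

Section ElementaryMaps.
Variables (K : countType) (Sg : signature K) (A B : structure Sg).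
Variable e : forall k, dom A k -> dom B k.
Hypothesis e_inj : forall k, injective (@e k).
Hypothesis e_fn : forall f (x : args (dom A) (fn_dom f)),
  e (fn_int x) = fn_int (args_hom e x).
Hypothesis e_pr : forall p (x : args (dom A) (pr_dom p)),
  pr_int x <-> pr_int (args_hom e x).

Lemma eval_hom (rho : assignment (dom A)) :
  (forall k (t : term Sg k), e (eval rho t) = eval (fun k n => e (rho k n)) t) /\
  (forall l (ts : terms Sg l),
     args_hom e (evals rho ts) = evals (fun k n => e (rho k n)) ts).
Proof.
apply: term_terms_ind => //=; first by move=> f ts <-; rewrite e_fn.
by move=> k l t -> ts ->.
Qed.

(** Only the quantifiers use the criterion: it moves a witness into the image of [e]. For [All] it
    is applied to [Not f], at a supposed counterexample. *)
Lemma tarski_vaught :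
  (forall (rho : assignment (dom A)) k n phi (d : dom B k),
     sat (update (fun k n => e (rho k n)) n d) phi ->
     exists a : dom A k, sat (update (fun k n => e (rho k n)) n (e a)) phi) ->
  forall phi rho, sat rho phi <-> sat (fun k n => e (rho k n)) phi.
Proof.
move=> tv.
elim=> [k t u|p ts||f IHf|f IHf g IHg|f IHf g IHg|f IHf g IHg
    |k n f IHf|k n f IHf] rho //=.
- by rewrite -!(proj1 (eval_hom rho)); split=> [->|/e_inj].
- by rewrite -(proj2 (eval_hom rho)) e_pr.
- by rewrite IHf.
- by rewrite IHf IHg.
- by rewrite IHf IHg.
- by rewrite IHf IHg.
- split=> sat_f d; last by apply/IHf; rewrite update_map.
  apply: contrapT => /(tv rho k n (Not f))[a]; apply.
  by rewrite -update_map; apply/IHf.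
- split=> [[d /IHf]|[d /(tv rho)[a]]].
    by rewrite update_map => sat_f; exists (e d).
  by rewrite -update_map => /IHf; exists a.
Qed.

Lemma sat_iso : (forall k (b : dom B k), exists a, e a = b) ->
  forall phi rho, sat rho phi <-> sat (fun k n => e (rho k n)) phi.
Proof.
move=> e_surj; apply: tarski_vaught => rho k n phi d sat_d.
by have [a ad] := e_surj _ d; exists a; rewrite ad.
Qed.

End ElementaryMaps.

(** Axioms have no free variables, so their truth at the one assignment of [B] gives their truth at
    all. *)
Lemma theory_equivalent (K : countType) (Sg : signature K)
    (T : structure Sg -> Prop) (A B : interpretation Sg) : is_theory T ->
  (forall phi, models A phi <-> models B phi) -> T A -> T B.
Proof.
case=> Ax Ax_sent T_Ax eqAB /T_Ax satA; apply/T_Ax => phi Ax_phi rho.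
apply/(@sat_ext _ _ _ _ _ (asg B)); first by rewrite Ax_sent.
by apply/eqAB/satA.
Qed.

(** * The downward Loewenheim-Skolem theorem *)

Definition select (X : Type) (x0 : X) (P : set X) : X :=
  if pselect (exists x, P x) is left ex_x then projT1 (cid ex_x) else x0.

Variant select_spec (X : Type) (x0 : X) (P : set X) : X -> Prop :=
| SelectSome x of P x : select_spec x0 P x
| SelectNone of (forall x, ~ P x) : select_spec x0 P x0.

Lemma selectP (X : Type) (x0 : X) (P : set X) : select_spec x0 P (select x0 P).
Proof.
rewrite /select; case: pselect => [ex_x|nex]; first by constructor; case: cid.
by constructor=> x Px; apply: nex; exists x.
Qed.

Section Cardinals.
Implicit Types X Y : Type.

Lemma card_leTP X Y :
  [set: X] #<= [set: Y] <-> exists f : X -> Y, injective f.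
Proof.
split=> [/card_leP[f]|[f f_inj]].
  exists (fun x => set_val (f (to_setT x))) => x y /val_inj /inj.
  by move=> /(_ (in_setT _) (in_setT _)) /(congr1 set_val).
have [g] : $|{injfun [set: X] >-> [set: Y]}|.
  by apply/injfunPex; exists f => // x y _ _ /f_inj.
exact: inj_card_le g.
Qed.

Lemma card_eqTP X Y :
  [set: X] #= [set: Y] <-> exists2 f : X -> Y, injective f & forall y, exists x, f x = y.
Proof.
split=> [/card_bijP[f [g fK gK]]|[f f_inj f_surj]].
  exists (fun x => set_val (f (to_setT x))).
    by move=> x y /val_inj /(can_inj fK) /(congr1 set_val).
  move=> y; exists (set_val (g (to_setT y))).
  by rewrite (_ : to_setT _ = g (to_setT y)) ?gK //; apply: val_inj.
have [g] : $|{bij [set: X] >-> [set: Y]}|.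
  apply/bijPex; exists f; split => // [x y _ _ /f_inj //|y _].
  by have [x <-] := f_surj y; exists x.
exact: pcard_eq g.
Qed.

End Cardinals.

Section DownwardLowenheimSkolem.
Variables (K : countType) (Sg : signature K) (A : structure Sg).
Local Notation D := (dom A).

Section Hull.
Variables (c : nat -> forall k, D k) (F : nat -> seq (forall k, D k) -> forall k, D k).

(* A tree denotes an element of every sort at once, so that the Skolem terms
   need no typing. *)
Fixpoint tree_val (t : GenTree.tree nat) : forall k, D k :=
  match t with
  | GenTree.Leaf n => c n
  | GenTree.Node m ts => F m (map tree_val ts)
  end.

Definition hull : family K := fun k => {d : D k | exists t, tree_val t k = d}.

Lemma hull_inj k : injective (@proj1_sig _ _ : hull k -> D k).
Proof.
by move=> [x Hx] [y Hy] /= xy; subst y; congr exist; apply: Prop_irrelevance.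
Qed.

Lemma countable_hull k : countable [set: hull k].
Proof.
apply: (@sub_countable _ _ _ [set: GenTree.tree nat]); last exact: countableP.
apply/card_leTP; exists (fun x => xget (GenTree.Leaf 0) [set t | tree_val t k = proj1_sig x]).
move=> x y eq_t; apply: hull_inj.
have get_val (z : hull k) :
    tree_val (xget (GenTree.Leaf 0) [set t | tree_val t k = proj1_sig z]) k = proj1_sig z.
  exact: (xgetPex _ (proj2_sig z)).
by rewrite -get_val eq_t get_val.
Qed.

End Hull.

Definition arg_list := seq (forall k, D k).

Fixpoint args_of (d : forall k, D k) (vs : arg_list) (l : seq K) : args D l :=
  match l with
  | [::] => tt
  | k :: l => (head d vs k, args_of d (behead vs) l)
  end.

(** A finite list stands for an assignment: position [pickle (k, n)] holds the value of variable [n]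
    of sort [k], and [d] fills the positions beyond its end. *)
Definition asg_of (d : forall k, D k) (vs : arg_list) : assignment D :=
  fun k n => nth d vs (pickle (k, n)) k.

(* Codes [inl f] close the hull under [f]; codes [inr (n, code phi)] provide
   witnesses for the [n]-th variable in [phi]. *)
Definition skolem_rel d m (vs : arg_list) k (x : D k) : Prop :=
  (exists f, m = pickle (inl f : fn Sg + (nat * nat)) /\
     existT D k x = existT D (fn_cod f) (fn_int (args_of d vs (fn_dom f)))) \/
  (exists n phi, m = pickle (inr (n, code phi) : fn Sg + (nat * nat)) /\
     sat (Defs.update (asg_of d vs) n x) phi).

Definition skolem (d : forall k, D k) m (vs : arg_list) : forall k, D k :=
  fun k => select (d k) (skolem_rel d m vs (k := k)).

Lemma skolem_fn d f vs :
  skolem d (pickle (inl f : fn Sg + (nat * nat))) vs (fn_cod f) =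
  fn_int (args_of d vs (fn_dom f)).
Proof.
rewrite /skolem; case: selectP => [x|/(_ (fn_int (args_of d vs (fn_dom f))))]; last first.
  by case; left; exists f.
case=> [[g [/(pcan_inj pickleK) [<-] eq_x]]|]; first exact: existT_inj eq_x.
by case=> n [phi [/(pcan_inj pickleK)]].
Qed.

Lemma skolem_ex d n phi vs k (x : D k) :
  sat (Defs.update (asg_of d vs) n x) phi ->
  sat (Defs.update (asg_of d vs) n
    (skolem d (pickle (inr (n, code phi) : fn Sg + (nat * nat))) vs k)) phi.
Proof.
move=> sat_x; rewrite /skolem; case: selectP => [y|/(_ x)]; last first.
  by case; right; exists n, phi.
case=> [[f [/(pcan_inj pickleK)]] //|].
by case=> m [psi [/(pcan_inj pickleK) [<- /code_inj <-]]].
Qed.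

End DownwardLowenheimSkolem.

(** Supplies constants for the hull. On a countable type they exhaust it, so the hull keeps its
    cardinality; otherwise they are distinct, so the hull is infinite. *)
Lemma countable_cover (X : Type) : inhabited X -> exists c : nat -> X,
  (countable [set: X] -> forall x, exists n, c n = x) /\
  (~ countable [set: X] -> injective c).
Proof.
case=> x0; case: (pselect (countable [set: X])) => [cX|ncX].
  have [f f_inj] := proj1 (card_leTP _ _) cX.
  exists (fun n => select x0 [set x | f x = n]); split=> // _ x.
  by exists (f x); case: selectP => [y /f_inj -> //|/(_ x) []].
have /infiniteP/card_leTP[c c_inj] : ~ finite_set [set: X].
  by move=> /finite_set_countable.
by exists c.
Qed.

(** The hull of the assigned values and the covering constants under the Skolem functions is
    elementary by the Tarski-Vaught criterion. The covering constants keep infinite sorts infinite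
    and countable sorts whole. *)
Lemma downward_lowenheim_skolem (K : countType) (Sg : signature K)
    (A : interpretation Sg) : exists B : interpretation Sg,
  (forall phi, models A phi <-> models B phi) /\
  forall k, [/\ countable [set: dom B k], infinite (dom A k) -> infinite (dom B k)
    & countable [set: dom A k] -> [set: dom B k] #= [set: dom A k]].
Proof.
pose c k := projT1 (cid (countable_cover (dom_inhabited A k))).
have c_cover k := projT2 (cid (countable_cover (dom_inhabited A k))).
(* Odd constants are the values of the variables, even ones the covering constants. *)
pose base n k := if odd n then asg A k n./2 else c k n./2.
pose d := base 0.
pose val := tree_val base (skolem d).
pose H := hull base (skolem d).
have in_hull k t : {x : H k | proj1_sig x = val t k}.
  by exists (exist _ (val t k) (ex_intro _ t erefl)).
have lift_args l (x : args H l) : exists ts,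
    args_of d (map val ts) l = args_hom (fun k => @proj1_sig _ _) x.
  elim: l x => [|k l IH] /= x; first by exists [::]; case: x.
  have [ts ts_x] := IH x.2; have [t t_x] := proj2_sig x.1.
  by exists (t :: ts); rewrite /= ts_x; congr pair.
pose up k (x : H k) : dom A k := proj1_sig x.
have fn_hull (f : fn Sg) (x : args H (fn_dom f)) :
    {y : H (fn_cod f) | up _ y = fn_int (args_hom up x)}.
  apply: cid; have [ts ts_x] := lift_args _ x.
  have [y y_val] := in_hull (fn_cod f)
    (GenTree.Node (pickle (inl f : fn Sg + (nat * nat))) ts).
  by exists y; rewrite /up y_val /= skolem_fn ts_x.
pose B0 := @Structure _ Sg H (fun k => inhabits (proj1_sig (in_hull k (GenTree.Leaf 0))))
   (fun f x => proj1_sig (fn_hull f x)) (fun p x => pr_int (args_hom up x)).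
have asg_hull k n : {x : H k | up _ x = asg A k n}.
  have [x x_val] := in_hull k (GenTree.Leaf n.*2.+1); exists x.
  by rewrite /up x_val /= /base /= odd_double /= uphalf_double.
pose B := @Interpretation _ Sg B0 (fun k n => proj1_sig (asg_hull k n)).
have up_fn (f : fn Sg) (x : args (dom B0) (fn_dom f)) :
    up _ (fn_int x) = fn_int (args_hom up x) := proj2_sig (fn_hull f x).
have up_inj k : injective (up k) by apply: hull_inj.
exists B; split.
  move=> phi; rewrite /models.
  have -> : asg A = fun k n => up k (asg B k n).
    by apply: functional_extensionality_dep => k; apply: funext => n;
       rewrite /= (proj2_sig (asg_hull k n)).
  apply: iff_sym; apply: (@tarski_vaught _ _ B0 A up up_inj up_fn _ _ phi (asg B)) => //.
  move=> {phi} rho k n phi a sat_a.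
  (* Every value of [rho] is named by a tree. Only the free variables of [phi] matter, and [N]
     exceeds their codes, so the finite list [ts] reaches them all. *)
  have [t t_rho] := choice (fun kj : K * nat => proj2_sig (rho kj.1 kj.2)).
  pose N := (\max_(v <- FV phi) pickle v).+1.
  pose ts := mkseq (fun p => if unpickle p is Some v then t v else GenTree.Leaf 0) N.
  have asg_ts (x : dom A k) : {in FV phi, forall v,
      Defs.update (fun k n => up k (rho k n)) n x v.1 v.2 =
      Defs.update (asg_of d (map val ts)) n x v.1 v.2}.
    move=> [k' n'] v_in /=; case: (eqVneq (k', n') (k, n)) => [[-> ->]|neq].
      by rewrite !update_eq.
    rewrite !update_neq //.
    have ltN : pickle (k', n') < N.
      by rewrite ltnS; apply: (@leq_bigmax_seq _ _ predT pickle).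
    have nth_ts : nth d (map val ts) (pickle (k', n')) = val (t (k', n')).
      by rewrite (nth_map (GenTree.Leaf 0)) ?size_mkseq // nth_mkseq // pickleK.
    by rewrite /asg_of nth_ts; symmetry; apply: (t_rho (k', n')).
  have /skolem_ex : sat (Defs.update (asg_of d (map val ts)) n a) phi.
    by apply/(sat_ext (asg_ts _)).
  have [y y_val] := in_hull k
    (GenTree.Node (pickle (inr (n, code phi) : fn Sg + (nat * nat))) ts).
  by move=> sat_y; exists y; apply/(sat_ext (asg_ts _)); rewrite /up y_val.
move=> k; have [c_surj c_inj] := c_cover k.
have c_hull n : {x : H k | up _ x = c k n}.
  have [x x_val] := in_hull k (GenTree.Leaf n.*2); exists x.
  by rewrite /up x_val /= /base odd_double doubleK.
have bij_up : countable [set: dom A k] -> [set: H k] #= [set: dom A k].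
  move=> /c_surj c_s; apply/card_eqTP; exists (up k) => // a.
  by have [n <-] := c_s a; have [x] := c_hull n; exists x.
split=> //; first exact: countable_hull.
move=> inf_A; case: (pselect (countable [set: dom A k])) => [/bij_up eqHA|/c_inj inj_c].
  by move=> /(card_le_finite _) fin; apply: inf_A; apply: fin; rewrite -(card_le_eql eqHA).
apply/infiniteP/card_leTP; exists (fun n => proj1_sig (c_hull n)) => m n.
move=> /(congr1 (up k)); rewrite (proj2_sig (c_hull m)) (proj2_sig (c_hull n)).
exact: inj_c.
Qed.

(** * Ultraproducts and compactness *)

Section Ultraproduct.
Variables (K : countType) (Sg : signature K) (I : Type) (A : I -> structure Sg).
Variables (U : set (set I)) (U_ultra : UltraFilter U).

Lemma ultra_not (X : set I) : U (~` X) <-> ~ U X.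
Proof.
split=> [UnX UX|nUX]; last by case: (in_ultra_setVsetC X U_ultra).
by apply: (@filter_not_empty _ U); rewrite -(setICr X); apply: filterI.
Qed.

Definition ultra_class k (f : forall i, dom (A i) k) : set (forall i, dom (A i) k) :=
  [set g | U [set i | f i = g i]].

Definition ultra_dom : family K := fun k =>
  {S : set (forall i, dom (A i) k) | exists f, S = ultra_class f}.

Definition ultra_pi k (f : forall i, dom (A i) k) : ultra_dom k :=
  exist _ (ultra_class f) (ex_intro _ f erefl).

(** Symbols are interpreted through fixed representatives, which spares proofs that they respect the
    classes; [ultra_piK] recovers agreement on a set of [U]. *)
Definition ultra_repr k (q : ultra_dom k) (i : I) : dom (A i) k :=
  projT1 (cid (proj2_sig q)) i.
Arguments ultra_repr : clear implicits.

Lemma ultra_pi_eq k (f g : forall i, dom (A i) k) :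
  U [set i | f i = g i] -> ultra_pi f = ultra_pi g.
Proof.
move=> Ufg; have eq_class : ultra_class f = ultra_class g.
  by apply/seteqP; split=> h; apply: filterS2 Ufg => i /= ->.
rewrite /ultra_pi; move: (ex_intro _ f _) (ex_intro _ g _).
by rewrite eq_class => p q; congr exist; apply: Prop_irrelevance.
Qed.

Lemma ultra_reprK k (q : ultra_dom k) : ultra_pi (ultra_repr k q) = q.
Proof.
case: q => S ex_f; rewrite /ultra_pi /ultra_repr /=; case: cid => f /= Sf; subst S.
by congr exist; apply: Prop_irrelevance.
Qed.

Lemma ultra_piK k (f : forall i, dom (A i) k) :
  U [set i | ultra_repr k (ultra_pi f) i = f i].
Proof.
rewrite /ultra_repr; case: cid => g /= eq_fg.
have : ultra_class f f by apply: filterS filterT.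
by rewrite eq_fg.
Qed.

Lemma ultra_repr_eq k (q r : ultra_dom k) :
  q = r <-> U [set i | ultra_repr k q i = ultra_repr k r i].
Proof.
split=> [->|/ultra_pi_eq]; first exact: filterS filterT.
by rewrite !ultra_reprK.
Qed.

Lemma ultra_dom_inhabited k : inhabited (ultra_dom k).
Proof.
constructor; apply: ultra_pi => i.
by have /cid[] : exists x : dom (A i) k, True by case: (dom_inhabited (A i) k) => x; exists x.
Qed.

Definition ultra_args i l (x : args ultra_dom l) : args (dom (A i)) l :=
  args_hom (fun k q => ultra_repr k q i) x.

Definition ultraproduct : structure Sg := @Structure _ Sg ultra_dom ultra_dom_inhabited
  (fun f x => ultra_pi (fun i => fn_int (ultra_args i x)))
  (fun p x => U [set i | pr_int (ultra_args i x)]).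

Definition ultra_asg (rho : assignment ultra_dom) i : assignment (dom (A i)) :=
  fun k n => ultra_repr k (rho k n) i.

(** An application picks a new representative of its result, so agreement with evaluation at each
    index holds only on a set of [U]. *)
Lemma eval_ultraproduct (rho : assignment (dom ultraproduct)) :
  (forall k (t : term Sg k),
     U [set i | ultra_repr k (eval rho t) i = eval (ultra_asg rho i) t]) /\
  (forall l (ts : terms Sg l),
     U [set i | ultra_args i (evals rho ts) = evals (ultra_asg rho i) ts]).
Proof.
apply: term_terms_ind => /=.
- by move=> k n; apply: filterS filterT.
- move=> f ts.
  by apply: filterS2 (ultra_piK (fun i => fn_int (ultra_args i (evals rho ts))))
    => i /= -> ->.
- exact: filterS filterT.
- by move=> k l t IHt ts; apply: filterS2 IHt => i; rewrite /ultra_args /= => -> <-.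
Qed.

Lemma ultra_asg_update (rho : assignment ultra_dom) k n (q : ultra_dom k) i :
  ultra_asg (Defs.update rho n q) i =
  Defs.update (ultra_asg rho i) n (ultra_repr k q i).
Proof. exact: (update_map (fun k q => ultra_repr k q i)). Qed.

(** The existential step of Los's theorem: witnesses are chosen index by index, with an arbitrary
    value where there is none, and their class is [q]. *)
Lemma ultra_select k (P : forall i, dom (A i) k -> Prop) :
  U [set i | exists d, P i d] <->
  exists q : ultra_dom k, U [set i | P i (ultra_repr k q i)].
Proof.
split=> [UP|[q]]; last by apply: filterS => i; exists (ultra_repr k q i).
have [d0 _] : exists q : ultra_dom k, True by case: (ultra_dom_inhabited k) => q; exists q.
pose g i := select (ultra_repr k d0 i) (P i).
exists (ultra_pi g); apply: filterS2 UP (ultra_piK g) => i /= [d Pd] ->; rewrite /g.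
by case: selectP => // /(_ d).
Qed.

(** Los's theorem. An ultrafilter decides every set, which handles [Not], [Or] and [Imp];
    existentials are [ultra_select], and universals are rewritten as negated existentials. *)
Lemma los phi (rho : assignment (dom ultraproduct)) :
  sat rho phi <-> U [set i | sat (ultra_asg rho i) phi].
Proof.
elim: phi rho => [k t u|p ts||f IHf|f IHf g IHg|f IHf g IHg|f IHf g IHg
    |k n f IHf|k n f IHf] rho /=.
- have Ut := proj1 (eval_ultraproduct rho) _ t.
  have Uu := proj1 (eval_ultraproduct rho) _ u.
  rewrite ultra_repr_eq; split=> Utu; apply: filterS3 Ut Uu Utu => i /=;
    first by move=> <- <-.
  by move=> -> ->.
- have Uts := proj2 (eval_ultraproduct rho) _ ts.
  by split=> Up; apply: filterS2 Uts Up => i /= ->.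
- by split=> // /(@filter_not_empty _ U).
- by rewrite IHf -ultra_not.
- rewrite IHf IHg; split=> [[]|Ufg]; first exact: filterI.
  by split; apply: filterS Ufg => i [].
- rewrite IHf IHg; split=> [[|]|Ufg]; [by apply: filterS; left|by apply: filterS; right|].
  apply: contrapT => /not_orP[/ultra_not Uf /ultra_not Ug].
  apply: (@filter_not_empty _ U); by apply: filterS3 Ufg Uf Ug => i [].
- rewrite IHf IHg; split=> [Ufg|Ufg Uf]; last by apply: filterS2 Ufg Uf => i /=; tauto.
  apply: contrapT => /ultra_not nUfg.
  suff [Uf /ultra_not nUg] : U [set i | sat (ultra_asg rho i) f] /\
      U (~` [set i | sat (ultra_asg rho i) g]) by apply: nUg; apply: Ufg.
  by split; apply: filterS nUfg => i /not_implyP[].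
- have -> : (forall q : ultra_dom k, sat (Defs.update rho n q) f) <->
      ~ exists q : ultra_dom k,
          U [set i | ~ sat (Defs.update (ultra_asg rho i) n (ultra_repr k q i)) f].
    split=> [sat_f [q]|ex_f q].
      move: (sat_f q); rewrite IHf => Uf nUf; apply: (@filter_not_empty _ U).
      by apply: filterS2 Uf nUf => i /=; rewrite ultra_asg_update.
    apply/IHf; apply: contrapT => /ultra_not nf; apply: ex_f; exists q.
    by apply: filterS nf => i /=; rewrite ultra_asg_update.
  rewrite -(ultra_select (fun i d => ~ sat (Defs.update (ultra_asg rho i) n d) f)) -ultra_not.
  split; apply: filterS => i /=.
    by move=> nex d; apply: contrapT => nsat; apply: nex; exists d.
  by move=> all_f [d]; apply.
- rewrite (ultra_select (fun i d => sat (Defs.update (ultra_asg rho i) n d) f)).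
  split=> -[q]; rewrite ?IHf => Uq; exists q.
    by apply: filterS Uq => i /=; rewrite ultra_asg_update.
  by apply/IHf; apply: filterS Uq => i /=; rewrite ultra_asg_update.
Qed.

(** Inject [nat] into each factor and take the class of the sequence of images of [n]. For different
    [m] and [n] the sequences disagree at every index, so the classes differ. *)
Lemma infinite_ultraproduct k :
  (forall i, infinite (dom (A i) k)) -> infinite (dom ultraproduct k).
Proof.
move=> inf_k; have inj_nat i : {c : nat -> dom (A i) k | injective c}.
  exact: cid (proj1 (card_leTP _ _) (proj1 (infiniteP _) (inf_k i))).
apply/infiniteP/card_leTP.
exists (fun n => ultra_pi (fun i => proj1_sig (inj_nat i) n)) => m n eq_mn.
apply: contrapT => neq_mn; apply: (@filter_not_empty _ U).
have := ultra_piK (fun i => proj1_sig (inj_nat i) m).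
rewrite eq_mn.
apply: filterS2 (ultra_piK (fun i => proj1_sig (inj_nat i) n)) => i /= ->.
by move=> /(proj2_sig (inj_nat i))/esym.
Qed.

End Ultraproduct.

(** The indices are the finite lists from [G], each with its model. The cones of lists extending a
    given one generate a filter; an ultrafilter above it contains, for each formula of [G], the set
    of indices whose model satisfies it. *)
Lemma compactness (K : countType) (Sg : signature K) (T : structure Sg -> Prop)
    (G : set (formula Sg)) (S1 : set K) : is_theory T ->
  (forall l, (forall phi, List.In phi l -> G phi) ->
     exists A : interpretation Sg, [/\ T A, forall phi, List.In phi l -> models A phi &
       forall k, S1 k -> infinite (dom A k)]) ->
  exists A : interpretation Sg, [/\ T A, forall phi, G phi -> models A phi &
    forall k, S1 k -> infinite (dom A k)].
Proof.
case=> Ax Ax_sent T_Ax fin_sat.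
pose I := {l | forall phi, List.In phi l -> G phi}.
have fin_sat' (i : I) := cid (fin_sat _ (proj2_sig i)).
pose A i := projT1 (fin_sat' i).
pose F : set (set I) :=
  [set X | exists i0 : I, forall i : I, List.incl (proj1_sig i0) (proj1_sig i) -> X i].
have F_proper : ProperFilter F.
  split; first by case=> i0 /(_ i0 (@List.incl_refl _ _)).
  split.
  - have nil_G phi : List.In phi [::] -> G phi by [].
    by exists (exist _ [::] nil_G).
  - move=> X Y [[lX GX] FX] [[lY GY] FY].
    have app_G phi : List.In phi (lX ++ lY) -> G phi.
      by move=> in_app; case: (List.in_app_or _ _ _ in_app); [apply: GX|apply: GY].
    exists (exist _ (lX ++ lY) app_G) => i /= /List.incl_app_inv[iX iY].
    by split; [apply: FX|apply: FY].
  - by move=> X Y XY [i0 FX]; exists i0 => i /FX /XY.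
have [U [U_ultra FU]] := ultraFilterLemma F_proper.
pose B0 := ultraproduct (fun i => str (A i)) U.
pose rho : assignment (dom B0) := fun k n => ultra_pi U (fun i => asg (A i) k n).
(* The representatives chosen for [rho] agree with the given assignments only on a set of [U] that
   depends on the variable, so finitely many variables are treated at a time. *)
have rho_asg (s : seq (K * nat)) :
    U [set i | {in s, forall v, ultra_asg rho i v.1 v.2 = asg (A i) v.1 v.2}].
  elim: s => [|[k n] s]; first by apply: filterS filterT.
  apply: filterS2 (ultra_piK U_ultra (fun i => asg (A i) k n)) => i /= rho_kn rho_s v.
  by rewrite inE => /predU1P[->|/rho_s].
have rho_models phi : U [set i | models (A i) phi] -> sat rho phi.
  move=> Uphi; apply/(los U_ultra); apply: filterS2 Uphi (rho_asg (FV phi)) => i /=.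
  by move=> sat_i rho_i; apply/(sat_ext rho_i).
exists (Interpretation rho); split.
- apply/T_Ax => phi Ax_phi r; apply/los; apply: filterS filterT => i _.
  by have [/T_Ax TAi _ _] := projT2 (fin_sat' i); apply: TAi.
- move=> phi G_phi; apply: rho_models; apply: FU.
  have phi_G psi : List.In psi [:: phi] -> G psi by case=> // <-.
  exists (exist _ [:: phi] phi_G) => i /= incl_i.
  by have [_ sat_i _] := projT2 (fin_sat' i); apply: sat_i; apply: incl_i; left.
- move=> k S1k; apply: infinite_ultraproduct => i.
  by have [_ _ inf_i] := projT2 (fin_sat' i); apply: inf_i.
Qed.

(** * Arrangements *)

Lemma In_mem (T : eqType) (s : seq T) (x : T) : List.In x s <-> x \in s.
Proof.
elim: s => //= y s ->; rewrite inE.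
by split=> [[->|->]|/predU1P[->|]]; rewrite ?eqxx ?orbT //; [left|right].
Qed.

(** * Conjunctions and blocks of existential quantifiers *)

Section FormulaConstructions.
Variables (K : countType) (Sg : signature K).

Lemma qf_conj (l : seq (formula Sg)) :
  (forall phi, List.In phi l -> qf phi) -> qf (conj l).
Proof.
elim: l => //= phi l IH qf_l; rewrite qf_l ?IH //; last by left.
by move=> psi psi_l; apply: qf_l; right.
Qed.

Lemma literal_qf (phi : formula Sg) : literal phi -> qf phi.
Proof. by case: phi => //= -[]. Qed.

Lemma sat_conj (A : structure Sg) (rho : assignment (dom A)) l :
  sat rho (conj l) <-> forall phi, List.In phi l -> sat rho phi.
Proof.
elim: l => [|phi l IH] /=; first by split=> // _; apply.
rewrite IH; split=> [[sat_phi sat_l] psi [<-|/sat_l]|sat_l] //.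
by split=> [|psi psi_l]; apply: sat_l; [left|right].
Qed.

Lemma sat_exists_vars (A : structure Sg) phi ws (rho : assignment (dom A)) :
  sat rho (exists_vars ws phi) <->
  exists2 rho' : assignment (dom A), sat rho' phi &
    forall k n, (k, n) \notin ws -> rho' k n = rho k n.
Proof.
elim: ws rho => [|[k n] ws IH] rho /=.
  split=> [sat_phi|[rho' sat_phi eq_rho]]; first by exists rho.
  by apply/(@sat_ext _ _ _ _ _ rho') => // -[k n] _; rewrite /= eq_rho.
split=> [[d /IH[rho' sat_phi eq_rho]]|[rho' sat_phi eq_rho]].
  exists rho' => // k' n'; rewrite inE negb_or => /andP[neq nin].
  by rewrite eq_rho // update_neq.
exists (rho' k n); apply/IH; exists rho' => // k' n' nin.
case: (eqVneq (k', n') (k, n)) => [[-> ->]|neq]; first by rewrite update_eq.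
by rewrite update_neq // eq_rho // inE negb_or neq.
Qed.

End FormulaConstructions.

Section Arrangements.
Variables (K K' : countType) (Sg : signature K) (i : K' -> K).
Variables (V : seq (K' * nat)) (E : K' -> rel nat).

Definition arranged k m n : formula Sg :=
  let e := Eq (i k) (Var (i k) m) (Var (i k) n) in if E k m n then e else Not e.

Lemma in_arrangement (phi : formula Sg) :
  List.In phi [seq arranged x.1 x.2 y.2 | x <- V, y <- [seq y <- V | y.1 == x.1]] <->
  exists k m n, [/\ (k, m) \in V, (k, n) \in V & phi = arranged k m n].
Proof.
have In_flatten (T : Type) (ss : seq (seq T)) x :
    List.In x (flatten ss) <-> exists s, List.In s ss /\ List.In x s.
  elim: ss => [|s ss IH] /=; first by split=> // -[? []].
  rewrite List.in_app_iff IH; split=> [[x_s|[s' [s'_ss x_s']]]|[s' [[->|s'_ss] x_s']]].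
  - by exists s; split; [left|].
  - by exists s'; split; [right|].
  - by left.
  - by right; exists s'.
rewrite In_flatten; split=> [[s [/List.in_map_iff[[k m] [<-]]]]|[k [m [n [km kn ->]]]]].
  move=> /In_mem km /List.in_map_iff[[k' n] [<- /In_mem]].
  rewrite mem_filter /= => /andP[/eqP-> kn].
  by exists k, m, n.
eexists; split; first by apply/List.in_map_iff; exists (k, m); split; last exact/In_mem.
apply/List.in_map_iff; exists (k, n); split=> //.
by apply/In_mem; rewrite mem_filter /= eqxx.
Qed.

Lemma arrangementE : arrangement Sg i V E =
  conj [seq arranged x.1 x.2 y.2 | x <- V, y <- [seq y <- V | y.1 == x.1]].
Proof. by []. Qed.

Lemma qf_arrangement : qf (arrangement Sg i V E).
Proof.
rewrite arrangementE; apply: qf_conj => phi /in_arrangement[k [m [n [_ _ ->]]]].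
by rewrite /arranged /=; case: ifP.
Qed.

Lemma FV_arrangement v : v \in FV (arrangement Sg i V E) ->
  exists2 x, x \in V & v = (i x.1, x.2).
Proof.
have FV_conj (l : seq (formula Sg)) :
    v \in FV (conj l) -> exists2 phi, List.In phi l & v \in FV phi.
  elim: l => //= phi l IH; rewrite mem_cat => /orP[v_phi|/IH[psi psi_l v_psi]].
    by exists phi; first left.
  by exists psi; first right.
rewrite arrangementE => /FV_conj[phi /in_arrangement[k [m [n [km kn ->]]]]].
have -> : FV (arranged k m n) = [:: (i k, m); (i k, n)] by rewrite /arranged /=; case: ifP.
by rewrite !inE => /orP[]/eqP ->; [exists (k, m)|exists (k, n)].
Qed.

Lemma sat_arrangement (A : structure Sg) (rho : assignment (dom A)) :
  sat rho (arrangement Sg i V E) <->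
  forall k m n, (k, m) \in V -> (k, n) \in V ->
    (rho (i k) m = rho (i k) n <-> E k m n).
Proof.
have sat_arranged k m n :
    sat rho (arranged k m n) <-> (rho (i k) m = rho (i k) n <-> E k m n).
  by rewrite /arranged /=; case: ifP => _ /=; intuition.
rewrite arrangementE sat_conj; split=> [sat_l k m n km kn|rhoE phi].
  by apply/sat_arranged/sat_l/in_arrangement; exists k, m, n.
by move=> /in_arrangement[k [m [n [km kn ->]]]]; apply/sat_arranged/rhoE.
Qed.

End Arrangements.

(** The list is the graph of a partial injection and is treated pair by pair: [g] is composed with
    the transposition of [x] and the [g]-preimage [x'] of [y]. Earlier pairs survive, because one
    that starts at [x] or [x'] must be [(x, y)] itself. *)
Lemma extend_bijection (X Y : Type) (s : seq (X * Y)) (b : X -> Y) :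
  injective b -> (forall y, exists x, b x = y) ->
  (forall p q, List.In p s -> List.In q s -> (p.1 = q.1 <-> p.2 = q.2)) ->
  exists g : X -> Y, [/\ injective g, forall y, exists x, g x = y &
    forall p, List.In p s -> g p.1 = p.2].
Proof.
move=> b_inj b_surj; elim: s => [|[x y] s IH] s_inj; first by exists b.
have [|g [g_inj g_surj g_s]] := IH.
  by move=> p q p_s q_s; apply: s_inj; right.
have [x' gx'] := g_surj y.
pose swap z := if pselect (z = x) is left _ then x'
  else if pselect (z = x') is left _ then x else z.
have swapK z : swap (swap z) = z.
  rewrite {2}/swap; case: pselect => [->|zx]; last case: pselect => [->|zx'];
  by rewrite /swap; do ![case: pselect => /= ?]; congruence.
exists (g \o swap); split=> [|z|p].
- by move=> z z' /g_inj eq_swap; rewrite -(swapK z) eq_swap swapK.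
- by have [z' <-] := g_surj z; exists (swap z'); rewrite /= swapK.
move=> p_in; have px : p.1 = x <-> p.2 = y by apply: (s_inj p (x, y)) => //; left.
have gp : p.1 <> x -> g p.1 = p.2 by case: p_in => [<- //|/g_s].
rewrite /= /swap; case: pselect => [/px ->|npx] //; case: pselect => [px'|] /=.
  by case: (npx); apply/px; rewrite -gp // px'.
by rewrite gp.
Qed.

(** * Amalgamation along the shared sorts *)

Section Reducts.
Variables (K K' : countType) (h : K -> K') (Sg : signature K) (Sg' : signature K').
Variables
  (app : forall f : fn Sg, terms Sg' (map h (fn_dom f)) -> term Sg' (h (fn_cod f)))
  (rel : forall p : pr Sg, terms Sg' (map h (pr_dom p)) -> formula Sg').
Variables (A : structure Sg') (rho : assignment (dom A)).
Variables
  (R_fn : forall f : fn Sg,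
     args (fun k => dom A (h k)) (fn_dom f) -> dom A (h (fn_cod f)))
  (R_pr : forall p : pr Sg, args (fun k => dom A (h k)) (pr_dom p) -> Prop).
Hypothesis app_eval : forall f us x,
  evals rho us = args_map x -> eval rho (@app f us) = R_fn x.
Hypothesis rel_sat : forall p us x,
  evals rho us = args_map x -> sat rho (@rel p us) <-> R_pr x.
Let R : structure Sg := @Structure _ Sg (fun k => dom A (h k))
  (fun k => dom_inhabited A (h k)) R_fn R_pr.
Let R_asg : assignment (dom R) := fun k n => rho (h k) n.

Lemma eval_tr :
  (forall k (t : term Sg k), eval rho (tr_term app t) = eval R_asg t) /\
  (forall l (ts : terms Sg l), evals rho (tr_terms app ts) = args_map (evals R_asg ts)).
Proof.
apply: term_terms_ind => //=; first by move=> f ts IH; apply: app_eval.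
by move=> k l t -> ts ->.
Qed.

(** A quantifier would rebind the variable at every sort with the same image under [h]; the literals
    to be translated have none. *)
Lemma sat_tr phi : qf phi -> sat rho (tr_formula app rel phi) <-> sat R_asg phi.
Proof.
elim: phi => //= [k t u|p ts|f IHf|f IHf g IHg|f IHf g IHg|f IHf g IHg].
- by rewrite !(proj1 eval_tr).
- by move=> _; apply: rel_sat; apply: (proj2 eval_tr).
- by move=> /IHf ->.
- by move=> /andP[/IHf -> /IHg ->].
- by move=> /andP[/IHf -> /IHg ->].
- by move=> /andP[/IHf -> /IHg ->].
Qed.

End Reducts.

Section UnionReducts.
Variables (C E1 E2 : countType).
Variables (Sg1 : signature (C + E1)%type) (Sg2 : signature (C + E2)%type).
Variables (A : structure (union_signature Sg1 Sg2)) (rho : assignment (dom A)).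

Lemma sat_emb1 phi : qf phi ->
  sat rho (emb1 Sg2 phi) <->
  @sat _ _ (reduct1 A) (fun k n => rho (sort1 E2 k) n) phi.
Proof. by apply: sat_tr => [f us x /= ->|p us x /= ->]. Qed.

Lemma sat_emb2 phi : qf phi ->
  sat rho (emb2 Sg1 phi) <->
  @sat _ _ (reduct2 A) (fun k n => rho (sort2 E1 k) n) phi.
Proof. by apply: sat_tr => [f us x /= ->|p us x /= ->]. Qed.

End UnionReducts.

Fixpoint args_comap (K K' : Type) (h : K -> K') (D : family K) (D' : family K')
    (e : forall k, D' (h k) -> D k) (l : seq K) : args D' (map h l) -> args D l :=
  match l return args D' (map h l) -> args D l with
  | [::] => id
  | k :: l => fun x => (e k x.1, args_comap e x.2)
  end.

Lemma args_comapK (K K' : Type) (h : K -> K') (D : family K) (D' : family K')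
    (e : forall k, D' (h k) -> D k) (e' : forall k, D k -> D' (h k)) :
  (forall k, cancel (e' k) (e k)) ->
  forall l (x : args D l), args_comap e (args_map (args_hom e' x)) = x.
Proof. by move=> e'K; elim=> [|k l IH] /= [] // a x; rewrite IH e'K. Qed.

(** * Gluing two structures along bijections of the shared sorts *)

Section Gluing.
Variables (C E1 E2 : countType).
Variables (Sg1 : signature (C + E1)%type) (Sg2 : signature (C + E2)%type).
Variables (A1 : structure Sg1) (A2 : structure Sg2).
Variables (g : forall c, dom A2 (inl c) -> dom A1 (inl c)).
Variables (g' : forall c, dom A1 (inl c) -> dom A2 (inl c)).
Hypotheses (gK : forall c, cancel (@g c) (@g' c)) (g'K : forall c, cancel (@g' c) (@g c)).

Definition amalgam_dom : family (C + (E1 + E2)) := fun k =>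
  match k with
  | inl c => dom A1 (inl c)
  | inr (inl e) => dom A1 (inr e)
  | inr (inr e) => dom A2 (inr e)
  end.

(** The carrier at [sort1 E2 k] reduces only once [k] is a constructor, so even identities need a
    case analysis on the sort. *)
Definition to1 k : dom A1 k -> amalgam_dom (sort1 E2 k) :=
  match k with inl _ => id | inr _ => id end.
Definition from1 k : amalgam_dom (sort1 E2 k) -> dom A1 k :=
  match k with inl _ => id | inr _ => id end.
Definition to2 k : dom A2 k -> amalgam_dom (sort2 E1 k) :=
  match k with inl c => @g c | inr _ => id end.
Definition from2 k : amalgam_dom (sort2 E1 k) -> dom A2 k :=
  match k with inl c => @g' c | inr _ => id end.

Lemma to1K k : cancel (@to1 k) (@from1 k). Proof. by case: k. Qed.
Lemma from1K k : cancel (@from1 k) (@to1 k). Proof. by case: k. Qed.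
Lemma to2K k : cancel (@to2 k) (@from2 k). Proof. by case: k => [c|e] //; apply: gK. Qed.
Lemma from2K k : cancel (@from2 k) (@to2 k). Proof. by case: k => [c|e] //; apply: g'K. Qed.

Lemma amalgam_dom_inhabited k : inhabited (amalgam_dom k).
Proof. by case: k => [c|[e|e]]; apply: dom_inhabited. Qed.

Definition amalgam : structure (union_signature Sg1 Sg2) :=
  @Structure _ (union_signature Sg1 Sg2) amalgam_dom amalgam_dom_inhabited
    (fun f => match f return args amalgam_dom (@fn_dom _ (union_signature Sg1 Sg2) f) ->
        amalgam_dom (@fn_cod _ (union_signature Sg1 Sg2) f) with
      | inl f => fun x => to1 (fn_int (args_comap from1 x))
      | inr f => fun x => to2 (fn_int (args_comap from2 x))
      end)
    (fun p => match p return
        args amalgam_dom (@pr_dom _ (union_signature Sg1 Sg2) p) -> Prop with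
      | inl p => fun x => pr_int (args_comap from1 x)
      | inr p => fun x => pr_int (args_comap from2 x)
      end).

Lemma sat_amalgam1 (rho : assignment (dom A1)) phi :
  sat rho phi <-> @sat _ _ (reduct1 amalgam) (fun k n => to1 (rho k n)) phi.
Proof.
apply: (@sat_iso _ _ A1 (reduct1 amalgam) to1) => [k|f x|p x|k b].
- exact: can_inj (@to1K k).
- by rewrite /= (args_comapK to1K).
- by rewrite /= (args_comapK to1K).
- by exists (from1 b); rewrite from1K.
Qed.

Lemma sat_amalgam2 (rho : assignment (dom A2)) phi :
  sat rho phi <-> @sat _ _ (reduct2 amalgam) (fun k n => to2 (rho k n)) phi.
Proof.
apply: (@sat_iso _ _ A2 (reduct2 amalgam) to2) => [k|f x|p x|k b].
- exact: can_inj (@to2K k).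
- by rewrite /= (args_comapK to2K).
- by rewrite /= (args_comapK to2K).
- by exists (from2 b); rewrite from2K.
Qed.

End Gluing.

(** * The combination theorem *)

Lemma pre_witness_cases (K : countType) (Sg : signature K) (T : structure Sg -> Prop)
    (S si nsi : set K) wit :
  [\/ strongly_stably_infinite T si nsi /\ strongly_polite T S nsi wit,
      [/\ stably_infinite2 T si nsi, smooth2 T nsi si & strong_witness T S nsi wit]
    | [/\ stably_infinite T si, smooth2 T nsi si & strong_witness2 T S nsi si wit]] ->
  pre_witness T wit.
Proof. by case=> [[_ [_ []]]|[_ _ []]|[_ _ []]]. Qed.

(** The order of the steps depends on the case, as each must preserve what the earlier ones
    achieved. The bound by [kappa] covers every finite witness, since the witness is found only
    inside the proof. *)
Lemma adjust_cardinals (K : countType) (Sg : signature K) (T : structure Sg -> Prop)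
    (S si nsi : set K) wit phi V E (kappa : family K) :
  [\/ strongly_stably_infinite T si nsi /\ strongly_polite T S nsi wit,
      [/\ stably_infinite2 T si nsi, smooth2 T nsi si & strong_witness T S nsi wit]
    | [/\ stably_infinite T si, smooth2 T nsi si & strong_witness2 T S nsi si wit]] ->
  qf phi -> (forall v, v \in V -> S v.1) -> equivalences E ->
  let psi := And (wit phi) (arrangement Sg id V E) in
  satisfiable T [set psi] ->
  (forall B : interpretation Sg, T B -> finitely_witnesses B nsi psi ->
     forall k, nsi k -> [set: dom B k] #<= [set: kappa k]) ->
  exists B : interpretation Sg, [/\ T B, models B psi, forall k, si k -> infinite (dom B k) &
    forall k, nsi k -> [set: dom B k] #= [set: kappa k]].
Proof.
move=> cases qf_phi V_S E_eqv psi sat_psi small.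
have qf_psi : qf psi.
  have [_ wit_qf _] := pre_witness_cases cases.
  by rewrite /= wit_qf ?qf_arrangement.
case: cases => [[ssi [sm [_ witP]]]|[sti sm [_ witP]]|[sti sm [_ witP]]].
(* Smoothness first brings the sorts of [nsi] to [kappa]; strong stable infiniteness then keeps
   those cardinalities. *)
- have [B TB wB] := witP phi V E qf_phi V_S E_eqv sat_psi.
  have [B' [TB' mB' B'_kappa]] := sm _ _ kappa qf_psi TB (proj1 wB) (small _ TB wB).
  have [B'' [TB'' mB'' inf_B'' B''_B']] := ssi _ _ qf_psi TB' mB'.
  exists B''; split=> // k nsi_k.
  exact: card_eq_trans (B''_B' _ nsi_k) (B'_kappa _ nsi_k).
(* Stable infiniteness comes first and does not enlarge the sorts of [nsi], which stay below
   [kappa]. Smoothness then raises them and keeps the sorts of [si] infinite. *)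
- have [B TB wB] := witP phi V E qf_phi V_S E_eqv sat_psi.
  have [B' [TB' mB' inf_B' B'_B]] := sti _ _ qf_psi TB (proj1 wB).
  have B'_kappa k : nsi k -> [set: dom B' k] #<= [set: kappa k].
    by move=> nsi_k; apply: card_le_trans (B'_B _ nsi_k) (small _ TB wB _ nsi_k).
  have [B'' [TB'' mB'' B''_kappa inf_B'']] := sm _ _ kappa qf_psi TB' mB' B'_kappa.
  by exists B''; split=> // k si_k; apply/inf_B''/inf_B'.
(* Stable infiniteness does not control [nsi] here, so it precedes the witness; the witness and
   smoothness both keep the sorts of [si] infinite. *)
- have [A [TA mA inf_A]] := sti _ qf_psi sat_psi.
  have [B [TB wB inf_B]] := witP phi V E qf_phi V_S E_eqv A TA mA.
  have [B' [TB' mB' B'_kappa inf_B']] := sm _ _ kappa qf_psi TB (proj1 wB) (small _ TB wB).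
  by exists B'; split=> // k si_k; apply/inf_B'/inf_B => //; apply: inf_A.
Qed.

(** * From a combined model to an arrangement, and from matched models to a combined one *)

Section Combination.
Variables (C E1 E2 : countType).
Variables (Sg1 : signature (C + E1)%type) (Sg2 : signature (C + E2)%type).
Variables (T1 : structure Sg1 -> Prop) (T2 : structure Sg2 -> Prop).
Hypotheses (T1_theory : is_theory T1) (T2_theory : is_theory T2).
Variables (Gamma1 : set (formula Sg1)) (Gamma2 : seq (formula Sg2)).
Hypothesis Gamma1_literals : forall phi, Gamma1 phi -> literal phi.
Hypothesis Gamma2_literals : forall phi, List.In phi Gamma2 -> literal phi.
Variables (wit : formula Sg2 -> formula Sg2) (T2_wit : pre_witness T2 wit).

Let qf_conj2 : qf (conj Gamma2).
Proof. by apply: qf_conj => phi /Gamma2_literals/literal_qf. Qed.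

Lemma combination_arrangement (V : seq (C * nat)) :
  (forall c n, (inl c, n) \in new_vars wit (conj Gamma2) -> ~ FVs Gamma1 (inl c, n)) ->
  satisfiable (combination T1 T2)
    (emb1 Sg2 @` Gamma1 `|` emb2 Sg1 @` [set phi | List.In phi Gamma2]) ->
  exists2 E : C -> rel nat, equivalences E &
    satisfiable T1 (Gamma1 `|` [set arrangement Sg1 inl V E]) /\
    satisfiable T2 [set wit (conj Gamma2); arrangement Sg2 inl V E].
Proof.
move=> wit_fresh [A [T1A T2A] A_models].
have [_ _ wit_equiv] := T2_wit.
pose A2 := @Interpretation _ _ (reduct2 A) (fun k n => asg A (sort2 E1 k) n).
have /wit_equiv : models A2 (conj Gamma2).
  apply/sat_conj => phi phi_in; apply/sat_emb2; first exact/literal_qf/Gamma2_literals.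
  by apply: A_models; right; exists phi.
move=> /(_ qf_conj2 T2A)/sat_exists_vars[rho2 sat_wit eq_rho2].
(* On shared sorts [rho1] copies [rho2], so both sides realise the same arrangement. *)
pose rho1 : assignment (dom (reduct1 A)) := fun k =>
  match k with inl c => rho2 (inl c) | inr e => asg A (inr (inl e)) end.
pose E c m n := `[< rho2 (inl c) m = rho2 (inl c) n >].
exists E.
  move=> c; apply/equivalence_relP; split=> [m|m n]; first exact/asboolP.
  by move=> /asboolP mn p; rewrite /E mn.
split.
  exists (Interpretation rho1) => // phi [phi_in|->]; last first.
    by apply/sat_arrangement => c m n _ _; split=> /asboolP.
  have sat_phi : models A (emb1 Sg2 phi) by apply: A_models; left; exists phi.
  move/(sat_emb1 _ (literal_qf (Gamma1_literals phi_in))): sat_phi.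
  apply: (iffLR (sat_ext _)) => -[[c|e] n] v_in //=.
  (* By freshness a shared variable of [Gamma1] is not new, so [rho2] left its value unchanged. *)
  symmetry; apply: (eq_rho2 (inl c)); apply/negP => /wit_fresh; apply.
  by exists phi.
exists (Interpretation rho2) => // phi [->|->] //.
by apply/sat_arrangement => c m n _ _; split=> /asboolP.
Qed.

Lemma amalgam_models (A1 : interpretation Sg1) (A2 : interpretation Sg2) :
  T1 A1 -> T2 A2 -> (forall phi, Gamma1 phi -> models A1 phi) ->
  models A2 (wit (conj Gamma2)) ->
  (forall c, exists g : dom A2 (inl c) -> dom A1 (inl c),
    [/\ injective g, forall b, exists a, g a = b &
      forall n, FVs Gamma1 (inl c, n) -> (inl c, n) \in FV (wit (conj Gamma2)) ->
        g (asg A2 (inl c) n) = asg A1 (inl c) n]) ->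
  satisfiable (combination T1 T2)
    (emb1 Sg2 @` Gamma1 `|` emb2 Sg1 @` [set phi | List.In phi Gamma2]).
Proof.
move=> T1A1 T2A2 A1_models A2_wit bij.
pose g c := projT1 (cid (bij c)).
have g_spec c : [/\ injective (g c), forall b, exists a, g c a = b &
    forall n, FVs Gamma1 (inl c, n) -> (inl c, n) \in FV (wit (conj Gamma2)) ->
      g c (asg A2 (inl c) n) = asg A1 (inl c) n] := projT2 (cid (bij c)).
have g_inj c : injective (g c) by case: (g_spec c).
have g_surj c b : {a | g c a = b} by apply: cid; case: (g_spec c).
pose g' c b := proj1_sig (g_surj c b).
have g'K c : cancel (g' c) (g c) by move=> b; apply: proj2_sig (g_surj c b).
have gK c : cancel (g c) (g' c) by move=> a; apply: (g_inj c); rewrite g'K.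
pose M := amalgam g g'.
(* Shared variables of [Gamma1] take their values from [A1], other shared variables from [A2] along
   [g]; on variables of both [Gamma1] and the witness formula the two agree. *)
pose rho : assignment (dom M) := fun k => match k return nat -> dom M k with
  | inl c => fun n => if pselect (FVs Gamma1 (inl c, n)) is left _
      then asg A1 (inl c) n else g c (asg A2 (inl c) n)
  | inr (inl e) => asg A1 (inr e)
  | inr (inr e) => asg A2 (inr e)
  end.
have T1M : T1 (reduct1 M).
  pose B1 := @Interpretation _ _ (reduct1 M) (fun k n => to1 A2 (asg A1 k n)).
  apply: (theory_equivalent (A := A1) (B := B1) T1_theory) T1A1 => phi.
  exact: (sat_amalgam1 g g').
have T2M : T2 (reduct2 M).
  pose B2 := @Interpretation _ _ (reduct2 M) (fun k n => to2 g (asg A2 k n)).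
  apply: (theory_equivalent (A := A2) (B := B2) T2_theory) T2A2 => phi.
  exact: (sat_amalgam2 gK g'K).
exists (Interpretation rho) => // phi [[phi1 phi1_in <-]|[phi2 phi2_in <-]].
  apply/sat_emb1; first exact/literal_qf/Gamma1_literals.
  move/A1_models/(sat_amalgam1 g g'): (phi1_in).
  apply: (iffLR (sat_ext _)) => -[[c|e] n] v_in //=.
  by case: pselect => // -[]; exists phi1.
apply/sat_emb2; first exact/literal_qf/Gamma2_literals.
move: phi2 phi2_in; apply/sat_conj.
have [_ _ wit_equiv] := T2_wit.
pose I2 := @Interpretation _ _ (reduct2 M) (fun k n => rho (sort2 E1 k) n).
(* [I2] already gives the new variables the values carried over from [A2], so its own assignment
   proves the existential closure. *)
apply/(wit_equiv _ qf_conj2 I2 T2M)/sat_exists_vars; exists (asg I2) => //.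
move/(sat_amalgam2 gK g'K): A2_wit; apply: (iffLR (sat_ext _)) => -[[c|e] n] v_in //=.
by case: pselect => // v_in1; have [_ _ ->] := g_spec c.
Qed.

End Combination.

(** Stable infiniteness speaks of one formula while [G] may be infinite: it is applied to
    conjunctions of finite parts, compactness collects them, and Loewenheim-Skolem makes the model
    countable. *)
Lemma countable_model (K : countType) (Sg : signature K) (T : structure Sg -> Prop)
    (S1 : set K) (G : set (formula Sg)) :
  is_theory T -> stably_infinite T S1 -> (forall phi, G phi -> qf phi) ->
  satisfiable T G ->
  exists A : interpretation Sg, [/\ T A, forall phi, G phi -> models A phi,
    forall k, S1 k -> infinite (dom A k) & forall k, countable [set: dom A k]].
Proof.
move=> T_theory T_si G_qf [I TI I_G].
have [l l_G|A [TA A_G inf_A]] := @compactness _ _ T G S1 T_theory.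
  have [||B [TB B_l inf_B]] := T_si (conj l).
  - by apply: qf_conj => phi /l_G /G_qf.
  - by exists I => // _ ->; apply/sat_conj => phi /l_G /I_G.
  by exists B; split=> //; apply/sat_conj.
have [B [eqAB cardB]] := downward_lowenheim_skolem A.
exists B; split=> [|phi /A_G/eqAB //|k /inf_A|k].
- exact: theory_equivalent eqAB TA.
- by case: (cardB k) => _ inf_B _ /inf_B.
- by case: (cardB k).
Qed.

(** * From an arrangement to a combined model *)

Section CombinationOfArranged.
Variables (C E1 E2 : countType).
Variables (Sg1 : signature (C + E1)%type) (Sg2 : signature (C + E2)%type).
Variables (T1 : structure Sg1 -> Prop) (T2 : structure Sg2 -> Prop).
Hypotheses (T1_theory : is_theory T1) (T2_theory : is_theory T2).
Variables (Gamma1 : set (formula Sg1)) (Gamma2 : seq (formula Sg2)).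
Hypothesis Gamma1_literals : forall phi, Gamma1 phi -> literal phi.
Hypothesis Gamma2_literals : forall phi, List.In phi Gamma2 -> literal phi.
Variables (wit : formula Sg2 -> formula Sg2).
Variables (Ssi : set C).
Let S : set (C + E2) := inl @` [set: C].
Let si : set (C + E2) := inl @` Ssi.
Let nsi : set (C + E2) := inl @` (~` Ssi).

(** The hypothesis on [V] serves twice: outside [Ssi] it makes every element of a finite witness the
    value of an arranged variable, and at all shared sorts it arranges the variables whose values
    the bijections must match. *)
Lemma arrangement_combination (V : seq (C * nat)) (E : C -> rel nat) :
  (forall c n, (inl c, n) \in FV (wit (conj Gamma2)) ->
     ~ Ssi c \/ FVs Gamma1 (inl c, n) -> (c, n) \in V) ->
  stably_infinite T1 (inl @` Ssi) ->
  [\/ strongly_stably_infinite T2 si nsi /\ strongly_polite T2 S nsi wit,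
      [/\ stably_infinite2 T2 si nsi, smooth2 T2 nsi si & strong_witness T2 S nsi wit]
    | [/\ stably_infinite T2 si, smooth2 T2 nsi si & strong_witness2 T2 S nsi si wit]] ->
  equivalences E ->
  satisfiable T1 (Gamma1 `|` [set arrangement Sg1 inl V E]) ->
  satisfiable T2 [set wit (conj Gamma2); arrangement Sg2 inl V E] ->
  satisfiable (combination T1 T2)
    (emb1 Sg2 @` Gamma1 `|` emb2 Sg1 @` [set phi | List.In phi Gamma2]).
Proof.
move=> V_wit T1_si T2_cases E_eqv sat1 [I2 T2I2 I2_models].
have [|A1 [T1A1 A1_models inf_A1 count_A1]] := countable_model T1_theory T1_si _ sat1.
  by move=> phi [/Gamma1_literals/literal_qf|->] //; apply: qf_arrangement.
have A1_arr := iffLR (sat_arrangement _ _ _ _) (A1_models _ (or_intror erefl)).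
(* The witness property concerns arrangements over the sorts of [Sg2], so [V] and [E] are retyped.
   At sorts in [E2], where [V'] has no variables, [E'] is set to equality. *)
pose V' : seq ((C + E2) * nat) := [seq (inl v.1, v.2) | v <- V].
have V'E c n : ((inl c, n) \in V') = ((c, n) \in V).
  apply/mapP/idP => [[[c' n'] v_in [-> ->]] //|v_in]; by exists (c, n).
pose E' (k : C + E2) : rel nat := if k is inl c then E c else fun m n => m == n.
have E'_eqv : equivalences E'.
  case=> [c|e]; first exact: E_eqv.
  by apply/equivalence_relP; split=> [m|m n] /=; [exact: eqxx|move=> /eqP->].
have arrE (B : interpretation Sg2) :
    models B (arrangement Sg2 id V' E') <-> models B (arrangement Sg2 inl V E).
  rewrite /models !sat_arrangement; split=> [arr c m n cm cn|arr [c|e] m n].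
  - by apply: (arr (inl c)); rewrite V'E.
  - by rewrite !V'E; apply: arr.
  - by move=> /mapP[[]].
(* The target cardinalities are those of [A1]; [unit] is a placeholder at sorts outside [nsi]. *)
pose kappa : family (C + E2) := fun k => if k is inl c then dom A1 (inl c) else unit.
have qf2 : qf (conj Gamma2) by apply: qf_conj => phi /Gamma2_literals/literal_qf.
have [v /mapP[[c n] _ ->]||B T2B [B_models B_wit]|B [T2B [B_wit /arrE B_arr] inf_B B_kappa]]
  := adjust_cardinals (V := V') (E := E') (kappa := kappa) T2_cases qf2 _ E'_eqv.
- by exists c.
- exists I2 => // _ ->; split; first by apply: I2_models; left.
  by apply/arrE; apply: I2_models; right.
- move=> _ [c nsi_c <-]; apply/card_leTP.
  (* Each element is named by an arranged variable and sent to that variable's value in [A1]; the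
     common arrangement makes this injective. *)
  have /choice[var var_asg] : forall d : dom B (inl c),
      exists n, (c, n) \in V /\ asg B (inl c) n = d.
    move=> d; have [|n n_FV <-] := B_wit (inl c) _ d; first by exists c.
    exists n; split=> //; move: n_FV; rewrite /= mem_cat => /orP[n_wit|].
      by apply: V_wit => //; left.
    by move=> /FV_arrangement[[k m]] kmV' [kE ->]; rewrite -V'E kE.
  have B_arr := iffLR (sat_arrangement _ _ _ _) (iffLR (arrE B) (proj2 B_models)).
  exists (fun d => asg A1 (inl c) (var d)) => d d'.
  have [dV d_asg] := var_asg d; have [d'V d'_asg] := var_asg d'.
  by move=> /(A1_arr _ _ _ dV d'V) /(B_arr _ _ _ dV d'V); rewrite d_asg d'_asg.
have [A2 [eqBA2 cardA2]] := downward_lowenheim_skolem B.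
have A2_arr := iffLR (sat_arrangement _ _ _ _) (iffLR (eqBA2 _) B_arr).
have T2A2 := theory_equivalent T2_theory eqBA2 T2B.
apply: (amalgam_models T1_theory T2_theory Gamma1_literals Gamma2_literals
  (pre_witness_cases T2_cases) T1A1 T2A2).
- by move=> phi phi_in; apply: A1_models; left.
- exact/eqBA2.
move=> c; have [count_A2 inf_A2 card_A2] := cardA2 (inl c).
have : [set: dom A2 (inl c)] #= [set: dom A1 (inl c)].
  (* In [Ssi] both carriers are countably infinite; elsewhere [B] has the countable cardinality of
     [A1], which Loewenheim-Skolem keeps. *)
  have [si_c|nsi_c] := pselect (Ssi c).
    have inf1 := inf_A1 (inl c) (ex_intro2 _ _ c si_c erefl).
    have inf2 := inf_A2 (inf_B (inl c) (ex_intro2 _ _ c si_c erefl)).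
    apply: card_eq_trans (eq_card_nat count_A2 inf2) _.
    by rewrite card_eq_sym; apply: eq_card_nat.
  have eqB1 : [set: dom B (inl c)] #= [set: dom A1 (inl c)].
    by apply: (B_kappa (inl c)); exists c.
  have count_B : countable [set: dom B (inl c)] by rewrite (eq_countable eqB1).
  exact: card_eq_trans (card_A2 count_B) eqB1.
move=> /card_eqTP[b b_inj b_surj].
(* Values of the arranged variables in [A2] and [A1]: a partial injection, since both models realise
   [E]. *)
pose s := [seq (asg A2 (inl c) v.2, asg A1 (inl c) v.2) | v <- V & v.1 == c].
have sP p : List.In p s <->
    exists2 n, (c, n) \in V & p = (asg A2 (inl c) n, asg A1 (inl c) n).
  rewrite List.in_map_iff; split=> [[[c' n] [<- /In_mem]]|[n cn ->]].
    by rewrite mem_filter /= => /andP[/eqP-> cn]; exists n.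
  by exists (c, n); split=> //; apply/In_mem; rewrite mem_filter /= eqxx.
have [|g [g_inj g_surj g_s]] := extend_bijection (s := s) b_inj b_surj.
  move=> p q /sP[m mV ->] /sP[n nV ->] /=.
  by rewrite (A1_arr _ _ _ mV nV) (A2_arr _ _ _ mV nV).
exists g; split=> // n n1 n2.
apply: (g_s (_, _)); apply/sP; exists n => //.
by apply: V_wit => //; right.
Qed.

End CombinationOfArranged.

Unset Implicit Arguments.

Theorem theorem4
  (C E1 E2 : countType)
  (Sg1 : signature (C + E1)%type) (Sg2 : signature (C + E2)%type)
  (T1 : structure Sg1 -> Prop) (T2 : structure Sg2 -> Prop)
  (T1_theory : is_theory T1) (T2_theory : is_theory T2)
  (Gamma1 : set (formula Sg1)) (Gamma2 : seq (formula Sg2))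
  (Gamma1_literals : forall phi, Gamma1 phi -> literal phi)
  (Gamma2_literals : forall phi, List.In phi Gamma2 -> literal phi)
  (Ssi : set C) (wit : formula Sg2 -> formula Sg2)
  (* the variables introduced by [wit] are fresh *)
  (wit_fresh : forall (c : C) (n : nat),
     (inl c, n) \in new_vars wit (conj Gamma2) -> ~ FVs Gamma1 (inl c, n))
  (V : seq (C * nat))
  (V_def : forall (c : C) (n : nat), (c, n) \in V <->
     (~ Ssi c /\ (inl c, n) \in FV (wit (conj Gamma2))) \/
     (Ssi c /\ FVs Gamma1 (inl c, n) /\ (inl c, n) \in FV (wit (conj Gamma2))))
  (T1_stably_infinite : stably_infinite T1 (inl @` Ssi))
  (T2_cases :
     let S : set (C + E2) := inl @` [set: C] in
     let si : set (C + E2) := inl @` Ssi in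
     let nsi : set (C + E2) := inl @` (~` Ssi) in
     [\/ strongly_stably_infinite T2 si nsi /\ strongly_polite T2 S nsi wit,
         [/\ stably_infinite2 T2 si nsi, smooth2 T2 nsi si
           & strong_witness T2 S nsi wit]
       | [/\ stably_infinite T2 si, smooth2 T2 nsi si
           & strong_witness2 T2 S nsi si wit]]) :
  satisfiable (combination T1 T2)
    (emb1 Sg2 @` Gamma1 `|` emb2 Sg1 @` [set phi | List.In phi Gamma2])
  <->
  exists2 E : C -> rel nat, equivalences E &
    satisfiable T1 (Gamma1 `|` [set arrangement Sg1 inl V E]) /\
    satisfiable T2 [set wit (conj Gamma2); arrangement Sg2 inl V E].
Proof.
split=> [|[E E_eqv [sat1 sat2]]].
  by apply: combination_arrangement => //; apply: pre_witness_cases T2_cases.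
apply: (arrangement_combination _ _ _ _ _ T1_stably_infinite T2_cases) sat1 sat2 => //.
move=> c n n_wit [nsi_c|n1]; apply/V_def; first by left.
by have [si_c|] := pselect (Ssi c); [right|left].
Qed.
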